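(* Fix real numbers $\alpha,\beta$ with $1/2<\alpha<\beta<1$ and put $\gamma=3/2-\alpha$. Let $k,m,n$ be positive integers with $k$ sufficiently large, $m\leqslant n$, $n^\alpha\leqslant k\leqslant m^\beta$, and $t(m+j)=t(n+j)$ for all $0\leqslant j\leqslant k$. Then $n=m+O(m^\gamma)$.
   Context: For $n\ge1$, $t(n)$ is the rooted planar tree of $n$: $t(1)$ is the single-vertex tree; if $n=p_1^{a_1}\cdots p_s^{a_s}$ with primes $p_1<\dots<p_s$ and $a_i\ge1$, then $t(n)$ is a root with $s$ edges ordered left to right, the $i$-th edge leading to a copy of $t(a_i)$. The implied constant in $O(\cdot)$ may depend on $\alpha,\beta$. *)

(* Defs.v *)
From mathcomp Require Import all_boot.

Set Implicit Arguments.
Unset Strict Implicit.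
Unset Printing Implicit Defensive.

(* Rooted planar trees: a root with the left-to-right list of its subtrees. *)
Inductive ptree : Type := PNode of seq ptree.

(* [prime_decomp n] lists the pairs (p, a) with p prime and a the exponent of
   p in n, by increasing p; it is empty for n = 1 (and for n = 0).
   The first argument is fuel; [factor_treeE] is the intended recursion. *)
Fixpoint factor_tree_rec (fuel n : nat) : ptree :=
  if fuel is fuel'.+1
  then PNode [seq factor_tree_rec fuel' pa.2 | pa <- prime_decomp n]
  else PNode [::].

Definition factor_tree (n : nat) : ptree := factor_tree_rec n n.

Lemma prime_decomp_exp_lt n p a :
  0 < n -> (p, a) \in prime_decomp n -> a < n.
Proof.
move=> n_gt0 /mem_prime_decomp[pr_p a_gt0 dvd_pa_n].
exact: leq_trans (ltn_expl a (prime_gt1 pr_p)) (dvdn_leq _ dvd_pa_n).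
Qed.

Lemma factor_tree_rec_fuel d n : n <= d -> factor_tree_rec d n = factor_tree n.
Proof.
rewrite /factor_tree; elim/ltn_ind: d n => -[|d] IH [|n] //= le_nd.
congr PNode; apply/eq_in_map => -[p a] /= /(prime_decomp_exp_lt (ltn0Sn _)) lt_an.
have le_an : a <= n by rewrite -ltnS lt_an.
by rewrite (IH d) ?(IH n) // (leq_trans le_an).
Qed.

Lemma factor_treeE n :
  factor_tree n = PNode [seq factor_tree pa.2 | pa <- prime_decomp n].
Proof.
case: n => [|n] //; rewrite {1}/factor_tree /=.
congr PNode; apply/eq_in_map => -[p a] /= /(prime_decomp_exp_lt (ltn0Sn _)) lt_an.
by apply: factor_tree_rec_fuel; rewrite -ltnS lt_an.
Qed.

(* Main.v *)
Require Import Defs.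
From mathcomp Require Import all_boot all_order all_algebra.
From mathcomp Require Import all_classical all_reals all_analysis.
From mathcomp Require Import ring lra zify.

Import Order.TTheory GRing.Theory Num.Theory.

(* In fact [n = m] as soon as [k] is large.  Otherwise let [h = n - m > 0] and
   let [p = O(log^2 h)] be the least odd prime not dividing [h].  Let
   [b < p] be congruent to [h] modulo [p].  As [k] exceeds [sqrt n] by a power
   of [n], there are [2p] consecutive integers [y] with [b^3 y^2] in
   [[n, n + k]]; for two of them, differing by [p], [b^3 y^2] is congruent to
   [h] modulo [p], and for at least one of these [p] divides [b^3 y^2 - h]
   exactly once.  But [b^3 y^2] is powerful, i.e. no child of the root of its
   tree is a leaf, whereas the tree of [b^3 y^2 - h] has such a child. *)

(** * Leaf children and exponents equal to 1 *)

Definition is_leaf (t : ptree) : bool := let: PNode s := t in nilp s.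

Definition has_leaf_child (t : ptree) : bool :=
  let: PNode s := t in has is_leaf s.

Lemma is_leaf_factor_tree a : 0 < a -> is_leaf (factor_tree a) = (a == 1).
Proof.
move=> a_gt0; rewrite factor_treeE /= /nilp size_map.
apply/idP/eqP => [|-> //]; rewrite size_eq0 => /eqP dec0.
by have := prod_prime_decomp a_gt0; rewrite dec0 big_nil.
Qed.

Lemma has_leaf_child_factor_treeP n :
  reflect (exists p, logn p n = 1) (has_leaf_child (factor_tree n)).
Proof.
rewrite factor_treeE /= has_map.
apply: (iffP hasP) => [[[p a] pa_in]|[p lognp]] /=.
  have [_ a_gt0 _] := mem_prime_decomp pa_in.
  rewrite is_leaf_factor_tree // => /eqP a1; exists p; move: pa_in.
  by rewrite prime_decompE => /mapP[q _ [-> <-]].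
exists (p, 1) => //=.
rewrite prime_decompE; apply/mapP; exists p; last by rewrite lognp.
by rewrite -logn_gt0 lognp.
Qed.

(** For positive [b] and [y] the exponent has the form [3u + 2v], which is never 1. *)
Lemma logn_cube_sqr_neq1 p b y : logn p (b ^ 3 * y ^ 2) <> 1.
Proof.
case: (posnP (b ^ 3 * y ^ 2)) => [->|]; first by rewrite logn0.
by rewrite muln_gt0 => /andP[b_gt0 y_gt0]; rewrite lognM // !lognX; lia.
Qed.

(** * Central binomial coefficients and the number of primes *)

Lemma expn2_leq_bin N : 2 ^ N <= 'C(N.*2, N).
Proof.
have factNN_gt0 : 0 < N`! * N`! by rewrite muln_gt0 fact_gt0.
rewrite -(leq_pmul2r factNN_gt0).
have -> : 'C(N.*2, N) * (N`! * N`!) = (N.*2)`!.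
  by have := @bin_fact N.*2 N; rewrite -addnn addnK => -> //; rewrite leq_addr.
(* The left side gains the factor [2(N+1)^2], the right side [(2N+2)(2N+1)]. *)
elim: N {factNN_gt0} => // N IHN.
rewrite doubleS !factS expnS.
apply: leq_trans (_ : N.*2.+2 * (N.*2.+1 * (2 ^ N * (N`! * N`!))) <= _).
  by nia.
by do 2!apply: leq_mul => //.
Qed.

(** Terms with [k > n] vanish, as [n < p ^ k]; a common range allows the sums for [(2N)!] and [N!]
    to be compared termwise. *)
Lemma logn_fact_wide p n L : prime p -> n <= L ->
  logn p n`! = \sum_(1 <= k < L.+1) n %/ p ^ k.
Proof.
move=> pr_p le_nL; rewrite logn_fact // [RHS](@big_cat_nat _ _ _ n.+1) //=.
rewrite [X in _ = _ + X]big_nat_cond [X in _ = _ + X]big1 ?addn0 // => k.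
case/andP => /andP[lt_nk _] _.
exact/divn_small/(ltn_trans lt_nk)/ltn_expl/prime_gt1.
Qed.

Lemma sum_leq_bound n T : \sum_(1 <= k < n.+1) (k <= T) <= T.
Proof.
suff -> : \sum_(1 <= k < n.+1) (k <= T) = minn n T by rewrite geq_minr.
elim: n => [|n IHn]; first by rewrite big_geq ?min0n.
by rewrite big_nat_recr //= IHn; lia.
Qed.

Lemma expn_logn_bin N p : prime p -> 0 < N -> p ^ logn p 'C(N.*2, N) <= N.*2.
Proof.
move=> pr_p N_gt0; have p_gt1 := prime_gt1 pr_p.
have NN_gt0 : 0 < N.*2 by rewrite double_gt0.
have le_NN : N <= N.*2 by rewrite -addnn leq_addr.
apply: leq_trans (trunc_logP p_gt1 NN_gt0); apply: leq_pexp2l (prime_gt0 pr_p) _.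
set T := trunc_log _ _.
have := congr1 (logn p) (bin_fact le_NN).
rewrite -{2}addnn addnK lognM ?bin_gt0 ?muln_gt0 ?fact_gt0 // lognM ?fact_gt0 //.
rewrite (logn_fact_wide _ _ _ pr_p (leqnn N.*2)) (logn_fact_wide _ _ _ pr_p le_NN).
(* Doubling a real raises twice its floor by at most 1, and the left side is 0 once [p ^ k > 2N],
   that is for [k > T]. *)
have step k : N.*2 %/ p ^ k <= N %/ p ^ k + N %/ p ^ k + (k <= T).
  have pk_gt0 : 0 < p ^ k by rewrite expn_gt0 prime_gt0.
  case: (leqP (p ^ k) N.*2) => [le_pk|lt_pk]; last by rewrite divn_small.
  rewrite (trunc_log_max p_gt1 le_pk) addn1 -ltnS ltn_divLR //.
  have := divn_eq N (p ^ k); have := ltn_pmod N pk_gt0; nia.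
have := @leq_sum _ (index_iota 1 N.*2.+1) predT _ _ (fun k _ => step k).
rewrite !big_split /=; have := sum_leq_bound N.*2 T; lia.
Qed.

(* Legendre: each prime power in the factorization of ['C(2N, N)] is at most
   [2N], so a large central binomial coefficient forces many primes. *)
Lemma expn2_leq_num_primes N : 0 < N ->
  2 ^ N <= N.*2 ^ size [seq q <- iota 0 N.*2.+1 | prime q].
Proof.
move=> N_gt0; apply: leq_trans (expn2_leq_bin N) _.
have C_gt0 : 0 < 'C(N.*2, N) by rewrite bin_gt0; lia.
set C := 'C(_, _) in C_gt0 *.
have prime_leq q : q \in primes C -> q <= N.*2.
  rewrite mem_primes => /and3P[pr_q _ q_dvd].
  apply: leq_trans (expn_logn_bin _ _ pr_q N_gt0).
  rewrite -{1}(expn1 q); apply: leq_pexp2l; first exact: prime_gt0.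
  by rewrite logn_gt0 mem_primes pr_q C_gt0.
apply: leq_trans (_ : N.*2 ^ size (primes C) <= _); last first.
  apply: leq_pexp2l; first by rewrite double_gt0.
  apply: uniq_leq_size (primes_uniq _) _ => q q_in.
  rewrite mem_filter mem_iota add0n ltnS prime_leq //= andbT.
  by move: q_in; rewrite mem_primes => /andP[].
rewrite {1}(prod_prime_decomp C_gt0) prime_decompE big_map /= -sum1_size expn_sum.
rewrite [leqLHS]big_seq [leqRHS]big_seq; apply: leq_prod => q.
by rewrite mem_primes expn1 => /and3P[pr_q _ _]; apply: expn_logn_bin.
Qed.

(** * A small odd prime not dividing [h] *)

Lemma prod_primes_dvdn (s : seq nat) h : uniq s -> all prime s ->
  all (fun q => q %| h) s -> \prod_(q <- s) q %| h.
Proof.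
elim: s => [|q s IHs] /=; first by rewrite big_nil dvd1n.
case/andP => q_notin uniq_s /andP[pr_q pr_s] /andP[q_dvd s_dvd].
rewrite big_cons Gauss_dvd ?q_dvd ?IHs // prime_coprime //.
rewrite Euclid_dvd_prod //; apply/negP; rewrite big_has => /hasP[r r_in].
have pr_r : prime r by apply: (allP pr_s).
rewrite dvdn_prime2 // => /eqP q_r.
by rewrite q_r r_in in q_notin.
Qed.

(* Solves [2 ^ N <= (2N) ^ M] for [N], using [2N < 2(s+1)^2 <= 2^(2s+1)] where
   [s] is the integer square root of [N]. *)
Lemma leq_of_expn2_leq N M : 0 < N -> 2 ^ N <= N.*2 ^ M -> N <= 16 * M ^ 2.
Proof.
move=> N_gt0 leN.
have [s /andP[le_sN lt_Ns]] : exists s, s ^ 2 <= N < s.+1 ^ 2.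
  elim: N {N_gt0 leN} => [|N [s /andP[le_s lt_s]]]; first by exists 0.
  case: (leqP (s.+1 ^ 2) N.+1) => [le_s1|lt_s1]; last first.
    by exists s; rewrite lt_s1 (leq_trans le_s).
  by exists s.+1; rewrite le_s1 /=; nia.
have s_gt0 : 0 < s by case: s lt_Ns {le_sN} => //; lia.
have le_2N : N.*2 <= 2 ^ (s + s).+1.
  have := ltn_expl s (ltnSn 1); rewrite expnS expnD => lt_s2.
  by rewrite -mul2n leq_mul2l /=; apply: leq_trans (ltnW lt_Ns) _; nia.
have : 2 ^ N <= 2 ^ ((s + s).+1 * M).
  by apply: leq_trans leN _; rewrite expnM; case: M => // M; rewrite leq_exp2r.
rewrite leq_exp2l // => leNM; have : s <= 3 * M by nia.
by nia.
Qed.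

(* [p] is the least such prime and [M] the number of primes below it, whose
   product divides [2h]; hence [M = O(log h)] and [p = O(log^2 h)]. *)
Lemma small_prime_notdvd h : 0 < h -> exists p M,
  [/\ prime p, odd p, ~~ (p %| h), 2 ^ M <= h.*2 & p <= 33 * M.+1 ^ 2].
Proof.
move=> h_gt0.
have [|p] := @ex_minnP (fun p => [&& prime p, odd p & ~~ (p %| h)]).
  have [p lt_p pr_p] := prime_above h.+2; exists p; rewrite pr_p /=.
  have [p2|->] := even_prime pr_p; first by rewrite p2 in lt_p.
  by apply/negP => /(dvdn_leq h_gt0); lia.
case/and3P=> pr_p odd_p p_ndvd min_p.
set s := [seq q <- iota 0 p | prime q].
exists p, (size s); split => //.
  (* By minimality of [p] the smaller odd primes divide [h]; doubling [h] takes care of the prime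
     2. *)
  have s_dvd : all (fun q => q %| h.*2) s.
    apply/allP => q; rewrite mem_filter mem_iota => /andP[pr_q lt_qp].
    have [->|odd_q] := even_prime pr_q; first by rewrite -mul2n dvdn_mulr.
    rewrite -mul2n dvdn_mull //; apply/negPn/negP => q_ndvd.
    by have := min_p q; rewrite pr_q odd_q q_ndvd => /(_ isT); lia.
  have dvd_h : \prod_(q <- s) q %| h.*2.
    by apply: prod_primes_dvdn; rewrite ?filter_uniq ?iota_uniq ?filter_all.
  apply: leq_trans (dvdn_leq _ dvd_h); last by rewrite double_gt0.
  rewrite -sum1_size expn_sum [leqLHS]big_seq [leqRHS]big_seq.
  by apply: leq_prod => q; rewrite mem_filter => /andP[/prime_gt1].
have p_gt2 : 2 < p by case: p pr_p odd_p {p_ndvd min_p s} => [|[|[|]]].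
(* With [N = p./2] the primes up to [2N] are those below [p], so [N <= 16 M^2] and
   [p <= 32 M^2 + 1]. *)
have p_half : p = (p./2).*2.+1 by rewrite -{1}(odd_double_half p) odd_p.
have half_gt0 : 0 < p./2 by lia.
have := leq_of_expn2_leq _ _ half_gt0 (expn2_leq_num_primes _ half_gt0).
by rewrite -p_half -/s; nia.
Qed.

(** * Powerful numbers in short intervals and residue classes *)

Lemma logn_eq1 p x : prime p -> 0 < x -> p %| x -> ~~ (p ^ 2 %| x) -> logn p x = 1.
Proof.
move=> pr_p x_gt0; rewrite -{1}(expn1 p) !pfactor_dvdn //; lia.
Qed.

(* [b] and [y] are [h] and [h^-1] modulo [p] (Fermat), up to a shift of [y] by
   [p], which changes [b ^ 3 * y ^ 2] by a non-multiple of [p ^ 2]. *)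
Lemma cube_sqr_congr p h : prime p -> odd p -> ~~ (p %| h) ->
  exists2 b, 0 < b < p & forall Y, exists2 y, Y <= y < Y + p.*2 &
    (b ^ 3 * y ^ 2 == h %[mod p]) && (b ^ 3 * y ^ 2 != h %[mod p ^ 2]).
Proof.
move=> pr_p odd_p p_ndvd; have p_gt0 := prime_gt0 pr_p.
have p_gt2 : 2 < p by case: p pr_p odd_p {p_ndvd p_gt0} => [|[|[|]]].
pose b := h %% p.
have b_bounds : 0 < b < p by rewrite /b ltn_mod p_gt0 andbT lt0n.
(* [Y * p.-1] is [-Y] modulo [p], so [y] is the representative of [h ^ (p - 2)] in [[Y, Y + p)]. *)
exists b => // Y; pose y := Y + (h ^ (p - 2) + Y * p.-1) %% p.
have y_mod : y = h ^ (p - 2) %[mod p].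
  by rewrite /y modnDmr addnCA -mulnS prednK // -modnDmr modnMl addn0.
have pow_mod d : b ^ 3 * (y + d * p) ^ 2 == h %[mod p].
  apply/eqP; rewrite -modnMm -[(y + _) ^ 2 %% p]modnXm addnC modnMDl y_mod modnXm.
  rewrite /b modnXm modnMm -expnM -expnD.
  (* This exponent lets [h ^ p = h] modulo [p] be applied twice. *)
  have -> : 3 + (p - 2) * 2 = p + p.-1 by lia.
  by rewrite expnD -modnMml fermat_little // modnMml -expnS prednK // fermat_little.
have y_ge : Y <= y by rewrite leq_addr.
have y_lt : y < Y + p by rewrite ltn_add2l ltn_mod.
clearbody b y => {y_mod}.
have y_mod_h : b ^ 3 * y ^ 2 == h %[mod p] by have := pow_mod 0; rewrite mul0n addn0.
have [y_eq|y_neq] := boolP (b ^ 3 * y ^ 2 == h %[mod p ^ 2]); last first.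
  by exists y; [lia | rewrite y_mod_h].
exists (y + p); [lia | have := pow_mod 1; rewrite mul1n => ->].
rewrite -(eqP y_eq) eqn_mod_dvd; last by rewrite leq_mul2l leq_exp2r // leq_addr orbT.
have -> : b ^ 3 * (y + p) ^ 2 = p * (b ^ 3 * (2 * y) + p * b ^ 3) + b ^ 3 * y ^ 2.
  by ring.
rewrite addnK.
rewrite -mulnn dvdn_pmul2l // dvdn_addl; last exact: dvdn_mulr.
(* [p] divides none of 2, [b], [y]: it is odd, exceeds [b], and [p %| y] would force [p %| h]. *)
rewrite Euclid_dvdM // Euclid_dvdX // Euclid_dvdM //.
apply/negP => /orP[/andP[/(dvdn_leq _) ] | /orP[/(dvdn_leq _)|p_dvd_y]]; try lia.
move: y_mod_h; rewrite expnS mulnCA -modnMml (eqP p_dvd_y) mul0n mod0n eq_sym.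
exact/negP.
Qed.

(* [b ^ 3 * y ^ 2] is powerful, so it cannot share its tree with the number
   [b ^ 3 * y ^ 2 - h], which [p] divides exactly once. *)
Lemma ltn_gap_of_factor_tree_eq k m h p : 0 < m -> prime p -> odd p -> ~~ (p %| h) ->
  (forall j, j <= k -> factor_tree (m + j) = factor_tree (m + h + j)) ->
  exists2 Y, Y ^ 2 < m + h & k < 4 * p ^ 4 * Y + 4 * p ^ 5.
Proof.
move=> m_gt0 pr_p odd_p p_ndvd eq_tree; have p_gt0 := prime_gt0 pr_p.
have [b /andP[b_gt0 lt_bp] /= choose_y] := cube_sqr_congr _ _ pr_p odd_p p_ndvd.
have b3_gt0 : 0 < b ^ 3 by rewrite expn_gt0 b_gt0.
have [|Y le_Y min_Y] := @ex_minnP (fun Y => m + h <= b ^ 3 * Y ^ 2).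
  by exists (m + h); nia.
case: Y le_Y min_Y => [|Y] le_Y min_Y; first by lia.
have lt_Y : b ^ 3 * Y ^ 2 < m + h.
  by rewrite ltnNge; apply/negP => /min_Y; rewrite ltnn.
exists Y; first by apply: leq_ltn_trans lt_Y; rewrite leq_pmull.
rewrite ltnNge; apply/negP => le_k.
have [y /andP[le_Yy lt_yY] /andP[y_mod y_mod2]] := choose_y Y.+1.
have le_y : m + h <= b ^ 3 * y ^ 2.
  by apply: leq_trans le_Y _; rewrite leq_mul2l leq_exp2r // le_Yy orbT.
(* As [y <= Y + 2p] and [b < p], going from [b ^ 3 * Y ^ 2 < m + h] to [b ^ 3 * y ^ 2] adds at most
   [4 p^4 Y + 4 p^5]. *)
have le_y' : b ^ 3 * y ^ 2 <= m + h + k.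
  have le_b3 : b ^ 3 <= p ^ 3 by rewrite leq_exp2r // ltnW.
  have : b ^ 3 * y ^ 2 <= b ^ 3 * (Y + p.*2) ^ 2.
    by rewrite leq_mul2l leq_exp2r //; apply/orP; right; lia.
  have : p ^ 3 * (4 * p * Y + 4 * p ^ 2) <= k.
    by apply: leq_trans le_k; apply/eq_leq; ring.
  have : b ^ 3 * (4 * p * Y + 4 * p ^ 2) <= p ^ 3 * (4 * p * Y + 4 * p ^ 2).
    by rewrite leq_mul2r le_b3 orbT.
  have -> : b ^ 3 * (Y + p.*2) ^ 2 = b ^ 3 * Y ^ 2 + b ^ 3 * (4 * p * Y + 4 * p ^ 2).
    by rewrite -muln2; ring.
  lia.
move: (fun q => logn_cube_sqr_neq1 q b y) le_y le_y' y_mod y_mod2.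
move: (b ^ 3 * y ^ 2) => N logN_neq1 le_N le_N' N_mod N_mod2 {le_k}.
have [j def_N] : exists j, N = m + h + j by exists (N - (m + h)); rewrite subnKC.
have j_le : j <= k by rewrite -(leq_add2l (m + h)) -def_N.
have mj : m + j = N - h by rewrite def_N addnAC addnK.
have le_hN : h <= N by rewrite def_N -addnA addnCA leq_addr.
have : has_leaf_child (factor_tree (m + j)).
  apply/has_leaf_child_factor_treeP; exists p.
  apply: logn_eq1; rewrite ?mj -?eqn_mod_dvd //.
  by rewrite -mj addn_gt0 m_gt0.
by rewrite eq_tree // -def_N => /has_leaf_child_factor_treeP[q /logN_neq1].
Qed.

(** * Polylogarithms against powers of [n] *)

Local Open Scope ring_scope.

Lemma polylog_sqrt_leq_powR (R : realType) (alpha : R) : 1 / 2 < alpha ->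
  exists n0 : nat, forall n M p Y : nat, (n0 <= n)%N ->
    (2 ^ M <= n.*2)%N -> (p <= 33 * M.+1 ^ 2)%N -> (Y ^ 2 < n)%N ->
    (4 * p ^ 4 * Y + 4 * p ^ 5)%:R <= n%:R `^ alpha :> R.
Proof.
(* With [u = n ^ delta], [n ^ alpha] is [u ^ 20] times the square root of [n]: ten factors [u] pay
   for [p ^ 5], ten for the constant [K]. *)
move=> alpha_gt; pose delta := (alpha - 1 / 2) / 20%:R.
have delta_gt0 : 0 < delta by rewrite /delta; lra.
have ln2_gt0 : 0 < ln 2 :> R by rewrite ln_gt0 // ltr1n.
(* From [(M - 1) ln 2 <= ln n = ln u / delta < u / delta] and [u >= 1] follows [M + 1 <= c u]. *)
pose c : R := 2 + (delta * ln 2)^-1.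
have c_gt0 : 0 < c by rewrite addr_gt0 // invr_gt0 mulr_gt0.
pose K : R := 8 * (33 * c ^+ 2) ^+ 5.
have K_gt0 : 0 < K by rewrite !(mulr_gt0, exprn_gt0).
(* This threshold ensures [K <= n ^ (10 delta)]; the successor makes [n] positive. *)
exists (Num.bound (K `^ (10 * delta)^-1)).+1 => n M p Y le_n le_M le_p lt_Y.
pose x : R := n%:R.
have x_ge1 : 1 <= x by rewrite ler1n; lia.
have x_gt0 : 0 < x by lra.
pose u := x `^ delta; pose r := x `^ (1 / 2).
have u_ge1 : 1 <= u by rewrite -(powRr0 x) ler_powR // ltW.
have r_ge1 : 1 <= r by rewrite -(powRr0 x) ler_powR //; lra.
have le_K : K <= u ^+ 10.
  have -> : u ^+ 10 = x `^ (10 * delta).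
    by rewrite -powR_mulrn ?powR_ge0 // -powRrM mulrC.
  have d10 : 0 < 10 * delta by lra.
  have -> : K = (K `^ (10 * delta)^-1) `^ (10 * delta).
    by rewrite -powRrM mulVf ?lt0r_neq0 // powRr1 // ltW.
  rewrite ge0_ler_powR ?nnegrE ?powR_ge0 // ?(ltW d10) ?(ltW x_gt0) //.
  apply/ltW/(lt_le_trans (archi_boundP (powR_ge0 _ _))).
  by rewrite ler_nat; lia.
have x_alpha : x `^ alpha = u ^+ 20 * r.
  rewrite -powR_mulrn ?powR_ge0 // -powRrM -powRD; last by rewrite (gt_eqF x_gt0) implybT.
  by congr (_ `^ _); rewrite /delta; field.
have le_Mu : M.+1%:R <= c * u.
  have : ln (2 ^+ M) <= ln (2 * x).
    rewrite ler_ln ?posrE ?exprn_gt0 ?mulr_gt0 //.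
    by rewrite -natrX -natrM ler_nat mul2n.
  rewrite lnXn // lnM ?posrE // -(mulr_natl (ln 2)) => le_ln.
  have : ln u < u by rewrite ln_sublinear // powR_gt0.
  rewrite ln_powR => lt_lnu.
  have : M%:R - 1 <= (delta * ln 2)^-1 * u.
    rewrite [leRHS]mulrC ler_pdivlMr ?(mulr_gt0 delta_gt0 ln2_gt0) //.
    apply/ltW/(le_lt_trans _ lt_lnu).
    by rewrite [leLHS]mulrCA ler_pM2l //; lra.
  rewrite -natr1 /c mulrDl; lra.
have le_pu : p%:R <= 33 * c ^+ 2 * u ^+ 2.
  apply: le_trans (_ : (33 * M.+1 ^ 2)%:R <= _); first by rewrite ler_nat.
  rewrite natrM natrX -mulrA -exprMn ler_pM2l //.
  by rewrite ler_pXn2r ?nnegrE // mulr_ge0 // ltW // powR_gt0.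
have le_Yr : Y%:R <= r.
  have <- : (Y%:R ^+ 2) `^ (1 / 2) = Y%:R :> R.
    by rewrite -powR_mulrn // -powRrM mulrC divfK // powRr1.
  apply: ge0_ler_powR; rewrite ?nnegrE ?exprn_ge0 ?(ltW x_gt0) //.
  by rewrite -natrX ler_nat ltnW.
have le_p5 : p%:R ^+ 5 <= (33 * c ^+ 2) ^+ 5 * u ^+ 10.
  rewrite (exprM u 2 5) -exprMn.
  by rewrite ler_pXn2r ?nnegrE // (le_trans _ le_pu).
have le_p45 : p%:R ^+ 4 <= p%:R ^+ 5 :> R.
  rewrite -!natrX ler_nat; case: (posnP p) => [->|p_gt0]; first by rewrite !exp0n.
  exact: leq_pexp2l.
have p4_ge0 : 0 <= p%:R ^+ 4 :> R by rewrite exprn_ge0.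
rewrite x_alpha natrD (natrM _ (4 * p ^ 4)%N) !(natrM _ 4%N) !natrX.
apply: le_trans (_ : 8 * p%:R ^+ 5 * r <= _).
  have : p%:R ^+ 4 * Y%:R <= p%:R ^+ 5 * r by rewrite ler_pM.
  have : p%:R ^+ 5 <= p%:R ^+ 5 * r :> R by rewrite ler_peMr // exprn_ge0.
  lra.
rewrite ler_wpM2r ?powR_ge0 //; apply: le_trans (_ : K * u ^+ 10 <= _).
  by rewrite /K -[leRHS]mulrA ler_pM2l.
by rewrite (exprD u 10 10) ler_wpM2r // exprn_ge0 // powR_ge0.
Qed.

Theorem theorem10 (R : realType) (alpha beta : R)
  (half_lt_alpha : 1 / 2 < alpha) (alpha_lt_beta : alpha < beta)
  (beta_lt1 : beta < 1) :
  let gamma : R := 3 / 2 - alpha in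
  exists (C : R) (k0 : nat), forall k m n : nat,
    (0 < k)%N -> (0 < m)%N -> (0 < n)%N ->
    (k0 <= k)%N ->
    (m <= n)%N ->
    n%:R `^ alpha <= k%:R ->
    k%:R <= m%:R `^ beta ->
    (forall j : nat, (j <= k)%N -> factor_tree (m + j)%N = factor_tree (n + j)%N) ->
    `|n%:R - m%:R| <= C * m%:R `^ gamma.
Proof.
have [n0 n0P] := polylog_sqrt_leq_powR _ _ half_lt_alpha.
exists 0, n0 => k m n k_gt0 m_gt0 n_gt0 le_n0k le_mn le_nk le_km eq_tree.
suff -> : n = m by rewrite subrr normr0 mul0r.
(* Thus [n0 <= k <= m <= n], so a large [k] forces a large [n]. *)
have le_km' : (k <= m)%N.
  rewrite -(ler_nat R) (le_trans le_km) // -[leRHS]powRr1 //.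
  by rewrite ler_powR ?ler1n // ltW.
apply/eqP; rewrite eqn_leq le_mn andbT leqNgt; apply/negP => lt_mn.
have h_gt0 : (0 < n - m)%N by rewrite subn_gt0.
have [p [M [pr_p odd_p p_ndvd le_M le_p]]] := small_prime_notdvd _ h_gt0.
have [|Y] := ltn_gap_of_factor_tree_eq k _ _ _ m_gt0 pr_p odd_p p_ndvd.
  by move=> j le_jk; rewrite subnKC // eq_tree.
(* The gap bound [k < 4 p^4 Y + 4 p^5] contradicts [4 p^4 Y + 4 p^5 <= n ^ alpha <= k]. *)
rewrite subnKC // => lt_Y; rewrite ltnNge => /negP; apply.
rewrite -(ler_nat R) (le_trans _ le_nk) //; apply: n0P le_p lt_Y.
  exact: leq_trans le_n0k (leq_trans le_km' le_mn).
by apply: leq_trans le_M _; rewrite leq_double leq_subr.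
Qed.
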